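(* Let $G$ be any finite group and let $p$ be a prime integer that divides the order of $G$. Then $$\#\{\text{irreducible } \mathbb{F}_p\text{-representations of } G\}\ \geq\ \sum_{\rho\in I_p}t_\rho,$$ where $I_p$ is the set of all rational irreducible representations $\rho$ of $G$ for which the corresponding number $\omega_\rho$ is not divisible by $p$, and $t_\rho$ is the number of different prime ideals in $\mathcal{O}_\rho$ that divide the principal ideal $(p)=p\mathcal{O}_\rho$.
   Context: Representations are counted up to isomorphism. For a rational irreducible representation $\rho\colon G\to\mathrm{Aut}(V_\rho)$ of a finite group $G$ ($V_\rho$ a simple $\mathbb{Q}G$-module): - $D_\rho=\mathrm{End}_{\mathbb{Q}G}(V_\rho)$ is the associated division algebra, $E_\rho$ is the center of $D_\rho$ (an algebraic number field, isomorphic to the field $\mathbb{Q}(\chi)$ generated by the values of the character $\chi$ of any irreducible complex constituent of $\mathbb{C}\otimes_{\mathbb{Q}}V_\rho$), and $\mathcal{O}_\rho$ is the ring of algebraic integers in $E_\rho$; - $k_\rho=|\ker\rho|$, $d_\rho$ is the dimension of any irreducible complex constituent of $\mathbb{C}\otimes_{\mathbb{Q}}V_\rho$, and $\omega_\rho=\dfrac{|G|}{k_\rho d_\rho}$, which is a positive integer. *)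

(* Defs.v *)
From mathcomp Require Import all_boot all_order all_fingroup all_algebra.
From mathcomp Require Import all_solvable all_field all_character.
From mathcomp Require Import finmap boolp classical_sets cardinality.

Set Implicit Arguments.
Unset Strict Implicit.
Unset Printing Implicit Defensive.

Import GRing.Theory.

Local Open Scope ring_scope.
Local Open Scope classical_set_scope.

(* [rho] lists every irreducible representation of G over F exactly once up to
   isomorphism. *)
Definition irr_system (F : fieldType) (gT : finGroupType) (G : {group gT})
    (I : finType) (rho : I -> representation F G) : Prop :=
  [/\ forall i, mx_irreducible (rho i),
      forall i j, mx_rsim (rho i) (rho j) -> i = j
    & forall (n : nat) (rG : mx_representation F G n),
        mx_irreducible rG -> exists i, mx_rsim rG (rho i)].

(* Such a finite list always exists, also when the characteristic of F divides
   the order of G: every irreducible representation is a composition factor of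
   the regular one. *)
Lemma irr_system_exists (F : fieldType) (gT : finGroupType) (G : {group gT}) :
  exists (I : finType) (rho : I -> representation F G), irr_system rho.
Proof.
have [U compU lastU] : exists2 U,
    mx_composition_series (regular_repr F G) U & (last 0 U :=: 1%:M)%MS.
  apply/asboolP/(@mx_Schreier _ _ _ _ (regular_repr F G) [::]) => //.
  by case=> U [compU lastU _]; apply/asboolP; exists U.
pose r (i : 'I_(size U)) := Representation (series_repr i compU).
pose sim i j := `[< mx_rsim (r i) (r j) >].
have simP i j : reflect (mx_rsim (r i) (r j)) (sim i j) by apply: asboolP.
pose first i := [forall j, sim i j ==> (i <= j)%N].
exists {i : 'I_(size U) | first i}, (fun i => r (val i)); split.
- by case=> i _ /=; apply: mx_series_repr_irr.
- move=> i j /= sij; apply/val_inj/val_inj/eqP; rewrite eqn_leq /=.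
  move/forallP/(_ (val j))/implyP: (valP i) => -> /=; last exact/simP.
  move/forallP/(_ (val i))/implyP: (valP j) => -> //.
  by apply/simP/mx_rsim_sym.
- move=> n rG irr_rG; have [i0 s0] := rsim_regular_series irr_rG compU lastU.
  have s00 : sim i0 i0 by apply/simP/mx_rsim_refl.
  case: (@arg_minnP _ i0 (sim i0) val s00) => i /simP si min_i.
  have fi : first i.
    apply/forallP=> j; apply/implyP=> /simP sij; apply: min_i.
    by apply/simP; apply: mx_rsim_trans sij.
  by exists (exist _ i fi); apply: mx_rsim_trans si.
Qed.

Section Ideals.

Variable T : pzRingType.

Definition integral_elt (x : T) : Prop :=
  exists2 q : {poly int}, q \is monic & \sum_(k < size q) x ^+ k *~ q`_k = 0.

(* Ideals of a commutative subring O of T; T itself need not be commutative. *)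
Definition is_ideal (O J : set T) : Prop :=
  [/\ J `<=` O, J 0, forall x y, J x -> J y -> J (x + y)
    & forall a x, O a -> J x -> J (a * x)].

Definition is_prime_ideal (O P : set T) : Prop :=
  [/\ is_ideal O P, ~ P 1
    & forall x y, O x -> O y -> P (x * y) -> P x \/ P y].

Definition ideal_mul (J K : set T) : set T :=
  [set x | exists2 s : seq (T * T),
             forall ab, ab \in s -> J ab.1 /\ K ab.2
           & x = \sum_(ab <- s) ab.1 * ab.2].

Definition ideal_dvd (O J L : set T) : Prop :=
  exists2 K, is_ideal O K & L = ideal_mul J K.

End Ideals.

Section Invariants.

Variables (gT : finGroupType) (G : {group gT}) (n : nat).
Variable rG : mx_representation rat G n.

(* Endomorphisms act on row vectors from the right, so that the product of
   matrices is the reversed composition; this does not change the centre. *)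
Definition repr_end : set 'M[rat]_n := [set A | centgmx rG A].

Definition repr_center : set 'M[rat]_n :=
  [set A | repr_end A /\ forall B, repr_end B -> A * B = B * A].

Definition repr_integers : set 'M[rat]_n :=
  [set A | repr_center A /\ integral_elt A].

Definition primes_above (p : nat) : set (set 'M[rat]_n) :=
  [set P | is_prime_ideal repr_integers P
         /\ ideal_dvd repr_integers P [set A *+ p | A in repr_integers]].

(* This set is finite for rG irreducible and p > 0; [fset_set] sends infinite
   sets to the empty one. *)
Definition num_primes_above (p : nat) : nat := #|` fset_set (primes_above p) |.

(* Complex characters have values in [algC]. All irreducible constituents of
   the complexification have the same degree when rG is irreducible; the value
   0 is only used in dimension 0, where there is no constituent. *)
Definition constt_degree : nat :=
  if [pick i in irr_constt (cfRepr (map_repr (ratr : rat -> algC) rG))] is Some i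
  then irr_degree (socle_of_Iirr i) else 0%N.

(* The quotient is exact when rG is irreducible. *)
Definition repr_omega : nat := (#|G| %/ (#|rker rG| * constt_degree))%N.

End Invariants.

(* Main.v *)
Require Import Defs.
From mathcomp Require Import all_boot all_order all_fingroup all_algebra.
From mathcomp Require Import all_solvable all_field all_character.
From mathcomp Require Import ring.
From mathcomp Require Import finmap boolp classical_sets cardinality.

Set Implicit Arguments.
Unset Strict Implicit.
Unset Printing Implicit Defensive.

Import GRing.Theory Num.Theory.
Local Open Scope ring_scope.

(** For a rational irreducible rho with p not dividing omega_rho, and a prime P of
    O_rho above p, consider the irreducible F_p-representations sigma lying over
    (rho, P): an integral combination of group elements that rho maps into P is
    killed by sigma.  By Nakayama's lemma P generates a proper ideal of the order
    spanned by rho(G), so some sigma lies over (rho, P); it suffices that sigma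
    determines rho and P.

    Put K = ker rho.  The commutators [g, h], with g and h running over
    representatives of G / K, sum to omega_rho^2 under rho, hence under sigma.  As
    sigma is constant on cosets of N = ker sigma, |N : K|^2 divides this sum, so p
    does not divide |N : K|.  The sum of N / K then acts on rho as a nonzero
    G-invariant operator, by Schur's lemma an invertible one, and N acts trivially.
    So ker sigma = ker rho.

    For a in O_rho, the element omega_rho a is the image under rho of an integral
    combination of representatives of G / K that every other rational irreducible
    with the same kernel kills: its coefficients are sums of lambda_chi(a) chi(g^-1)
    over the complex constituents chi of rho, where a acts on chi as lambda_chi(a),
    and these sums are rational algebraic integers.  With a = 1 this recovers rho
    from sigma.  If P and P' both lie under sigma and a is in P,
    take a monic f in Z[X] of least degree with f(a) in P', and write f = c + X g.
    Lifting omega f(a) and omega a g(a) shows that p divides c, so a g(a) is in P',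
    and minimality forces a into P'. *)

(** * Intertwiners and Schur orthogonality *)

Section Intertwiners.

Variables (F : fieldType) (gT : finGroupType) (G : {group gT}) (m n : nat).
Variables (X : mx_representation F G m) (Y : mx_representation F G n).

Definition intertwines (B : 'M_(m, n)) :=
  forall x, x \in G -> X x *m B = B *m Y x.

Lemma intertwines_row_free B :
  mx_irreducible X -> intertwines B -> B != 0 -> row_free B.
Proof.
case/mx_irrP=> _ irrX homB nzB; rewrite -kermx_eq0; apply: contraNT nzB => nzK.
have modK : mxmodule X (kermx B).
  apply/mxmoduleP=> x Gx; apply/sub_kermxP.
  by rewrite -mulmxA homB // mulmxA mulmx_ker mul0mx.
have := irrX _ modK nzK; rewrite -sub1mx => /sub_kermxP.
by rewrite mul1mx => ->.
Qed.

Lemma intertwines_row_full B :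
  mx_irreducible Y -> intertwines B -> B != 0 -> row_full B.
Proof.
case/mx_irrP=> _ irrY homB nzB.
have modB : mxmodule Y <<B>>%MS.
  by apply/mxmoduleP=> x Gx; rewrite genmxE (eqmxMr _ (genmxE _)) -homB ?submxMl.
have := irrY _ modB; rewrite -mxrank_eq0 genmxE mxrank_eq0 => /(_ nzB).
by rewrite -!sub1mx genmxE.
Qed.

Lemma intertwines_rsim B :
  mx_irreducible X -> mx_irreducible Y -> intertwines B -> B != 0 -> mx_rsim X Y.
Proof.
move=> irrX irrY homB nzB.
have freeB := intertwines_row_free irrX homB nzB.
have fullB := intertwines_row_full irrY homB nzB.
by exists B => //; exact: etrans (esym (eqP freeB)) (eqP fullB).
Qed.

(** The averaging operator without division by |G|, so that it makes sense in every
    characteristic. *)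
Definition average (M : 'M_(m, n)) := \sum_(g in G) X g^-1%g *m M *m Y g.

Lemma average_intertwines M : intertwines (average M).
Proof.
move=> x Gx; rewrite mulmx_sumr mulmx_suml (reindex_inj (mulIg x)) /=.
apply: eq_big => [g | g]; first by rewrite groupMr.
rewrite groupMr // => Gg; rewrite repr_mxM // invMg repr_mxM ?groupV //.
by rewrite !mulmxA -repr_mxM ?groupV // mulgV repr_mx1 mul1mx.
Qed.

Lemma average0_orthogonal A :
  (forall M, average M = 0) -> \sum_(g in G) \tr (A *m X g^-1%g) *: Y g = 0.
Proof.
move=> av0; apply/matrixP=> s t; rewrite summxE [RHS]mxE.
(* The (k, t) entry of the average of [M k] is the sum over g of (X(g^-1) A)_kk Y(g)_st, so summing
   over k produces the trace. *)
pose M k := A *m delta_mx k s : 'M_(m, n).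
transitivity (\sum_k average (M k) k t); last first.
  by rewrite big1 // => k _; rewrite av0 mxE.
under [RHS]eq_bigr do rewrite summxE.
rewrite exchange_big /=; apply: eq_bigr => g Gg.
rewrite mxE mxtrace_mulC mulr_suml; apply: eq_bigr => k _.
rewrite [RHS]mxE (bigD1 s) //= big1 ?addr0 => [|u nsu].
  congr (_ * _); rewrite !mxE; apply: eq_bigr => l _; rewrite !mxE.
  rewrite (bigD1 k) //= !mxE !eqxx mulr1 big1 ?addr0 // => v nvk.
  by rewrite !mxE (negPf nvk) mulr0.
rewrite mxE big1 ?mul0r // => l _; rewrite !mxE big1 ?mulr0 // => v _.
by rewrite !mxE (negPf nsu) andbF mulr0.
Qed.

End Intertwiners.

Lemma irr_orthogonal (F : fieldType) (gT : finGroupType) (G : {group gT}) m n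
    (X : mx_representation F G m) (Y : mx_representation F G n) A :
    mx_irreducible X -> mx_irreducible Y -> ~ mx_rsim X Y ->
  \sum_(g in G) \tr (A *m X g^-1%g) *: Y g = 0.
Proof.
move=> irrX irrY nXY; apply: average0_orthogonal => M; apply/eqP.
apply: contra_notT nXY; apply: intertwines_rsim => //.
exact: average_intertwines.
Qed.

(** If every average vanished, the trace of the orthogonality relation with A = 1 would make the
    inner product of the characters zero. A nonzero average is injective because its source is
    irreducible. *)
Lemma constt_intertwiner (gT : finGroupType) (G : {group gT}) n
    (Y : mx_representation algC G n) (i : Iirr G) :
    i \in irr_constt (cfRepr Y) ->
  exists2 B, intertwines 'Chi_i Y B & row_free B.
Proof.
move=> ciY; have [av0 | /existsNP[M /eqP nzM]] :=
  pselect (forall M, average 'Chi_i Y M = 0); last first.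
  exists (average 'Chi_i Y M); first exact: average_intertwines.
  by apply: intertwines_row_free nzM; [apply: socle_irr | apply: average_intertwines].
case/eqP: ciY; rewrite cfdotE; set S := (X in _ * X); suff -> : S = 0 by rewrite mulr0.
have /(congr1 mxtrace) := average0_orthogonal 1%:M av0.
rewrite raddf_sum raddf0 /= => tr0; rewrite -[RHS]tr0; apply: eq_bigr => g Gg.
rewrite mxtraceZ mulrC -irrRepr -char_inv ?cfRepr_char //.
by rewrite !cfunE Gg groupV Gg !mulr1n mul1mx.
Qed.

(** * Central characters and integrality *)

(** Spelled exactly as the sum in [integral_elt], so that the two are convertible. *)
Definition eval_intpoly (T : pzRingType) (q : {poly int}) (x : T) : T :=
  \sum_(k < size q) x ^+ k *~ q`_k.

Section CentralCharacters.

Variables (gT : finGroupType) (G : {group gT}) (n : nat).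
Variable rG : mx_representation rat G n.
Hypothesis irrG : mx_irreducible rG.

Local Notation toC := (map_mx (ratr : rat -> algC)).
Local Notation rC := (map_repr (ratr : rat -> algC) rG).
Local Notation theta := (cfRepr rC).

(** Jacobson density: for an irreducible module the double centralizer is the enveloping algebra. *)
Lemma repr_center_envelop A :
  repr_center rG A -> (A \in enveloping_algebra_mx rG)%MS.
Proof.
case=> _ cA; apply: submx_trans (mx_Jacobson_density irrG).
by apply/cent_mxP=> B; rewrite memmx_cent_envelop => /cA.
Qed.

Lemma intertwiner_envelop d (X : mx_representation algC G d) B (c : gT -> rat) :
    intertwines X rC B ->
  (\sum_(h in G) ratr (c h) *: X h) *m B
    = B *m toC (\sum_(h in G) c h *: rG h).
Proof.
move=> homB; rewrite raddf_sum /= mulmx_suml mulmx_sumr.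
by apply: eq_bigr => h Gh; rewrite map_mxZ -scalemxAl -scalemxAr homB.
Qed.

Lemma constt_scalar d (X : mx_representation algC G d) B (c : gT -> rat) :
    mx_irreducible X -> intertwines X rC B -> row_free B ->
    centgmx rG (\sum_(h in G) c h *: rG h) ->
  exists l, \sum_(h in G) ratr (c h) *: X h = l%:M.
Proof.
move=> irrX homB freeB /centgmxP cAG.
apply/is_scalar_mxP; apply: mx_abs_irr_cent_scalar (groupC irrX) _ _.
apply/centgmxP=> x Gx; apply: (row_free_inj freeB) => /=.
rewrite -!mulmxA homB // [in RHS]intertwiner_envelop // !mulmxA.
rewrite intertwiner_envelop // homB // -!mulmxA /= -!map_mxM /=.
by congr (_ *m map_mx _ _); apply: cAG.
Qed.

(** A is a combination of the rG(h). The same combination taken in a complex constituent commutes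
    with G, since the constituent embeds into the complexification, and is therefore a scalar; the
    trace formula follows by decomposing the character. *)
Lemma center_scalars A : repr_center rG A ->
  exists l : Iirr G -> algC,
    (forall i B, i \in irr_constt theta -> intertwines 'Chi_i rC B ->
       B *m toC A = l i *: B)
  /\ (forall g, g \in G -> ratr (\tr (A *m rG g))
       = \sum_(i in irr_constt theta) '[theta, 'chi_i] * l i * 'chi_i g).
Proof.
move=> cA; have /centgmxP cAG := cA.1.
have /envelop_mxP[c defA] := repr_center_envelop cA.
pose S (i : Iirr G) := \sum_(h in G) ratr (c h) *: 'Chi_i h.
have actS i B : intertwines 'Chi_i rC B -> S i *m B = B *m toC A.
  by rewrite defA; apply: intertwiner_envelop.
have scalS i : i \in irr_constt theta -> exists l, S i = l%:M.
  move=> /constt_intertwiner[B homB freeB].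
  by apply: constt_scalar (socle_irr _) homB freeB _; rewrite -defA; case: cA.
have /fin_all_exists[l Sl] i : exists l, i \in irr_constt theta -> S i = l%:M.
  have [/scalS[l] | _] := boolP (i \in irr_constt theta); last by exists 0.
  by exists l.
exists l; split=> [i B ci /actS <- | g Gg]; first by rewrite Sl // mul_scalar_mx.
transitivity (\sum_(h in G) ratr (c h) * theta (h * g)%g).
  rewrite {1}defA mulmx_suml (raddf_sum (@mxtrace _ _)) rmorph_sum.
  apply: eq_bigr => h Gh.
  rewrite /= -scalemxAl mxtraceZ rmorphM /= -repr_mxM // cfunE groupM // mulr1n.
  by rewrite trace_map_mx.
rewrite {1}(cfun_sum_constt theta).
under eq_bigr do rewrite sum_cfunE mulr_sumr.
rewrite exchange_big; apply: eq_bigr => i ci.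
under eq_bigr do rewrite cfunE mulrCA.
rewrite -mulr_sumr -mulrA; congr (_ * _).
rewrite -irrRepr [in RHS]cfunE Gg mulr1n -mxtraceZ -mul_scalar_mx -Sl //.
rewrite mulmx_suml raddf_sum; apply: eq_bigr => h Gh /=.
by rewrite -scalemxAl mxtraceZ cfunE groupM // mulr1n repr_mxM.
Qed.

Section Faithful.

Variables (d : nat) (B : 'M[algC]_(d, n)).
Hypothesis nzB : B != 0.

(** By Schur's lemma a nonzero A would be invertible and could not kill B. Identities between
    rational endomorphisms can thus be checked on a single complex constituent. *)
Lemma constt_faithful A : centgmx rG A -> B *m toC A = 0 -> A = 0.
Proof.
move=> cA BA0; apply/eqP; apply: contraTT nzB => nzA; rewrite negbK.
have uA := mx_Schur irrG cA nzA.
have uAC : toC A \in unitmx by rewrite map_unitmx.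
by rewrite -(mulmxK uAC B) BA0 mul0mx.
Qed.

Lemma eigen_eval A l q :
  B *m toC A = l *: B -> B *m toC (eval_intpoly q A) = eval_intpoly q l *: B.
Proof.
move=> BA; rewrite /eval_intpoly raddf_sum mulmx_sumr scaler_suml.
apply: eq_bigr => k _; rewrite raddfMz /= -scaler_int -scalemxAr.
suff -> : B *m toC (A ^+ k) = l ^+ k *: B by rewrite scalerA mulrzl.
elim: (k : nat) => [|j IHj]; first by rewrite !expr0 map_mx1 mulmx1 scale1r.
by rewrite !exprSr map_mxM mulmxA IHj -scalemxAl BA scalerA mulrC.
Qed.

(** A and its eigenvalue l are roots of the same integer polynomials: in one direction by evaluating
    on B, in the other by [constt_faithful] applied to the minimal polynomial of l. *)
Lemma integral_eltP A l : repr_end rG A -> B *m toC A = l *: B ->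
  integral_elt A <-> l \in Aint.
Proof.
move=> /centgmxP cA BA.
have evalE (q : {poly int}) : (map_poly intr q).[l] = eval_intpoly q l.
  rewrite horner_coef size_map_inj_poly ?rmorph0 //; last exact: intr_inj.
  by apply: eq_bigr => k _; rewrite coef_map /= mulrzl.
split=> [[q monq q0] | /floorpP[q Dq]].
  apply: (@root_monic_Aint (map_poly intr q)).
  - apply/rootP; rewrite evalE; apply/eqP; move/eqP: (eigen_eval q BA).
    rewrite [eval_intpoly q A]q0 map_mx0 mulmx0 eq_sym scalemx_eq0.
    by rewrite (negPf nzB) orbF.
  - exact: monic_map.
  - by apply/polyOverP=> k; rewrite coef_map /= rpred_int.
exists q.
  have /monicP := minCpoly_monic l.
  rewrite Dq lead_coef_map_inj ?rmorph0 //; last exact: intr_inj.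
  by move=> lq; apply/monicP/(intr_inj (R := algC)).
apply: constt_faithful; last first.
  rewrite (eigen_eval q BA) -evalE -Dq.
  by rewrite (rootP (root_minCpoly l)) scale0r.
apply/centgmxP=> x Gx; rewrite mulmx_suml mulmx_sumr; apply: eq_bigr => k _.
rewrite -[_ *~ _]scaler_int -scalemxAl -scalemxAr; congr (_ *: _).
elim: (k : nat) => [|j IHj]; first by rewrite expr0 mul1mx mulmx1.
by rewrite exprS -mulmxA IHj !mulmxA cA.
Qed.

End Faithful.

Lemma repr_end1 : repr_end rG 1.
Proof. by apply/centgmxP=> x Gx; rewrite mulmx1 mul1mx. Qed.

Lemma repr_endB A B : repr_end rG A -> repr_end rG B -> repr_end rG (A - B).
Proof.
move=> /centgmxP cA /centgmxP cB; apply/centgmxP=> x Gx.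
by rewrite mulmxBl mulmxBr cA ?cB.
Qed.

Lemma repr_endM A B : repr_end rG A -> repr_end rG B -> repr_end rG (A * B).
Proof.
move=> /centgmxP cA /centgmxP cB; apply/centgmxP=> x Gx.
by rewrite -mulmxA cB // !mulmxA cA.
Qed.

Lemma repr_center1 : repr_center rG 1.
Proof. by split=> [|B _]; [apply: repr_end1 | rewrite mulr1 mul1r]. Qed.

Lemma repr_centerB A B :
  repr_center rG A -> repr_center rG B -> repr_center rG (A - B).
Proof.
move=> [eA cA] [eB cB]; split=> [|C eC]; first exact: repr_endB.
by rewrite mulrBl mulrBr cA ?cB.
Qed.

Lemma repr_centerM A B :
  repr_center rG A -> repr_center rG B -> repr_center rG (A * B).
Proof.
move=> [eA cA] [eB cB]; split=> [|C eC]; first exact: repr_endM.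
by rewrite -mulrA cB // !mulrA cA.
Qed.

Lemma irr_repr_dim_gt0 : (n > 0)%N.
Proof. by case/mx_irrP: irrG. Qed.

Lemma constt_degreeP :
  exists2 i, i \in irr_constt theta & constt_degree rG = irr_degree (socle_of_Iirr i).
Proof.
rewrite /constt_degree; case: pickP => [i ci | noi]; first by exists i.
suff: theta 1%g == 0 by rewrite cfRepr1 pnatr_eq0 -leqn0 leqNgt irr_repr_dim_gt0.
by rewrite (cfun_sum_constt theta) big_pred0 ?cfunE.
Qed.

Lemma irr_intertwiner : exists i,
  [/\ i \in irr_constt theta, constt_degree rG = irr_degree (socle_of_Iirr i)
    & exists2 B, intertwines 'Chi_i rC B & row_free B].
Proof.
have [i ci di] := constt_degreeP; exists i; split=> //.
exact: constt_intertwiner.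
Qed.

Lemma row_free_neq0 (F : fieldType) d m (B : 'M[F]_(d, m)) :
  (d > 0)%N -> row_free B -> B != 0.
Proof. by move=> d_gt0; rewrite -mxrank_eq0 -lt0n => /eqP->. Qed.

(** Passing to eigenvalues on one constituent reduces closure to the fact that algebraic integers
    form a ring. *)
Lemma repr_integers_sub_mul A A' :
    repr_integers rG A -> repr_integers rG A' ->
  repr_integers rG (A - A') /\ repr_integers rG (A * A').
Proof.
have [i [ci _ [B homB freeB]]] := irr_intertwiner.
have nzB := row_free_neq0 (irr_degree_gt0 _) freeB.
move=> [cA iA] [cA' iA'].
have [l [/(_ i B ci homB) lA _]] := center_scalars cA.
have [l' [/(_ i B ci homB) lA' _]] := center_scalars cA'.
have intP C k := integral_eltP nzB (A := C) (l := k).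
have [eA eA'] := (cA.1, cA'.1).
have [_ subAint mulAint] := Aint_subring.
have Al : l i \in Aint := (intP A (l i) eA lA).1 iA.
have Al' : l' i \in Aint := (intP A' (l' i) eA' lA').1 iA'.
have cB := repr_centerB cA cA'; have cM := repr_centerM cA cA'.
split.
  split; first exact: cB.
  apply/(intP _ (l i - l' i)); first exact: cB.1.
    by rewrite map_mxB mulmxBr lA lA' scalerBl.
  exact: subAint.
split; first exact: cM.
apply/(intP _ (l i * l' i)); first exact: cM.1.
  by rewrite map_mxM mulmxA lA -scalemxAl lA' scalerA.
exact: mulAint.
Qed.

Lemma integral_elt1 (T : pzRingType) : integral_elt (1 : T).
Proof.
exists ('X - 1%:P); first exact: monicXsubC.
rewrite size_XsubC 2!big_ord_recl big_ord0 !coefB !coefX !coefC /=.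
by rewrite !expr1n addr0 sub0r subr0 mulrN1z addNr.
Qed.

Lemma repr_integers1 : repr_integers rG 1.
Proof. by split; [apply: repr_center1 | apply: integral_elt1]. Qed.

Lemma repr_integersB A B :
  repr_integers rG A -> repr_integers rG B -> repr_integers rG (A - B).
Proof. by move=> iA iB; have [] := repr_integers_sub_mul iA iB. Qed.

Lemma repr_integersM A B :
  repr_integers rG A -> repr_integers rG B -> repr_integers rG (A * B).
Proof. by move=> iA iB; have [] := repr_integers_sub_mul iA iB. Qed.

Lemma repr_integers0 : repr_integers rG 0.
Proof. by rewrite -(subrr 1); apply: repr_integersB repr_integers1 repr_integers1. Qed.

Lemma repr_integersN A : repr_integers rG A -> repr_integers rG (- A).
Proof. by rewrite -sub0r; apply: repr_integersB repr_integers0. Qed.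

Lemma repr_integersD A B :
  repr_integers rG A -> repr_integers rG B -> repr_integers rG (A + B).
Proof. by move=> iA /repr_integersN/(repr_integersB iA); rewrite opprK. Qed.

Lemma repr_integers_intr (z : int) : repr_integers rG z%:~R.
Proof.
have posz (k : nat) : repr_integers rG k%:~R.
  elim: k => [|k IHk]; first by rewrite mulr0z; apply: repr_integers0.
  by rewrite intS mulrzDr; apply: repr_integersD repr_integers1 IHk.
by case: z => k //; rewrite NegzE mulrNz; apply: repr_integersN (posz _).
Qed.

End CentralCharacters.

(** * Class functions acting on irreducible representations *)

Section ClassSums.

Variables (gT : finGroupType) (G : {group gT}).

Lemma irr_scalar_trace d (X : mx_representation algC G d) A :
  mx_irreducible X -> centgmx X A -> A = (\tr A / d%:R)%:M.
Proof.
move=> irrX cA; have [d_gt0 _] := (mx_irrP _).1 irrX.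
have /is_scalar_mxP[a ->] := mx_abs_irr_cent_scalar (groupC irrX) cA.
by rewrite mxtrace_scalar -[a *+ d]mulr_natr mulfK // pnatr_eq0 -lt0n.
Qed.

(** The left side commutes with G because f is a class function, so it is a scalar, determined by
    its trace. *)
Lemma cfun_irr_scalar d (X : mx_representation algC G d) (f : 'CF(G)) :
    mx_irreducible X ->
  \sum_(g in G) f g *: X g^-1%g = (#|G|%:R * '[f, cfRepr X] / d%:R)%:M.
Proof.
move=> irrX; set S := LHS; rewrite [S](irr_scalar_trace irrX).
  congr (_ / _)%:M; rewrite cfdotE mulVKf ?neq0CG // raddf_sum /=.
  apply: eq_bigr => g Gg; rewrite mxtraceZ -char_inv ?cfRepr_char //.
  by rewrite cfunE groupV Gg mulr1n.
apply/centgmxP=> x Gx; rewrite mulmx_suml mulmx_sumr.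
rewrite (reindex_inj (conjg_inj x^-1%g)) /=.
apply: eq_big => [g | g]; rewrite groupJr ?groupV // => Gg.
rewrite cfunJ ?groupV // -scalemxAl -scalemxAr -!repr_mxM ?groupV ?groupJ ?groupV //.
by rewrite -conjVg conjgE invgK -!mulgA mulVg mulg1.
Qed.

(* The inner sum over h acts as (|G| / d) chi(g), and the outer one as |G| / d. *)
Lemma commutator_sum_irr i : let d := irr_degree (@socle_of_Iirr _ G i) in
  \sum_(g in G) \sum_(h in G) 'Chi_i [~ g, h] = ((#|G|%:R / d%:R) ^+ 2)%:M.
Proof.
move=> d; move defX: ('Chi_i) => X.
have irrX : mx_irreducible X by rewrite -defX; apply: socle_irr.
have chiX : cfRepr X = 'chi_i.
  by rewrite -defX irrRepr.
transitivity (\sum_(g in G) (#|G|%:R / d%:R) *: ('chi_i g *: X g^-1%g)).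
  apply: eq_bigr => g Gg.
  have cS : centgmx X (average X X (X g)).
    by apply/centgmxP=> x Gx; rewrite average_intertwines.
  transitivity (X g^-1%g *m average X X (X g)).
    rewrite mulmx_sumr; apply: eq_bigr => h Gh.
    by rewrite commgEl -!repr_mxM ?groupM ?groupV // conjgE !mulgA.
  rewrite (irr_scalar_trace irrX cS) mul_mx_scalar scalerA; congr (_ *: _).
  rewrite mulrAC; congr (_ / _); rewrite -chiX cfunE Gg mulr1n mulr_natl.
  rewrite raddf_sum -sumr_const; apply: eq_bigr => h Gh /=.
  by rewrite mxtrace_mulC mulmxA -repr_mxM ?groupV // mulgV repr_mx1 mul1mx.
rewrite -scaler_sumr cfun_irr_scalar // chiX cfnorm_irr mulr1.
by rewrite scale_scalar_mx expr2.
Qed.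

End ClassSums.

(** * Coset representatives *)

Section CosetTransversal.

Variables (gT : finGroupType) (G : {group gT}).

Definition coset_reps (K : {set gT}) := [set x in G | repr (K :* x)%g == x].

Lemma coset_reps_sub (K : {set gT}) g : g \in coset_reps K -> g \in G.
Proof. by rewrite inE => /andP[]. Qed.

Lemma repr_coset_reps (K : {group gT}) g :
  K \subset G -> g \in G -> repr (K :* g)%g \in coset_reps K.
Proof.
move=> sKG Gg; have Kg := mem_repr_rcoset K g; rewrite inE.
have /rcoset_eqP -> := Kg; rewrite eqxx andbT.
by have /rcosetP[k Kk ->] := Kg; rewrite groupM // (fintype.subsetP sKG).
Qed.

Lemma coset_reps_fiber (K : {group gT}) t g : K \subset G -> t \in coset_reps K ->
  (g \in G) && (repr (K :* g)%g == t) = (g \in K :* t)%g.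
Proof.
move=> sKG; rewrite inE => /andP[Gt /eqP Dt]; apply/andP/idP=> [[_ /eqP Dg] | Ktg].
  by rewrite rcoset_sym -Dg mem_repr_rcoset.
have /rcoset_eqP-> := Ktg; rewrite Dt; split=> //.
by have /rcosetP[k Kk ->] := Ktg; rewrite groupM // (fintype.subsetP sKG).
Qed.

Lemma sum_coset_reps (V : nmodType) (K : {group gT}) (f : gT -> V) :
    K \subset G -> {in K & G, forall k g, f (k * g)%g = f g} ->
  \sum_(g in G) f g = (\sum_(g in coset_reps K) f g) *+ #|K|.
Proof.
move=> sKG fK.
rewrite (partition_big (fun g => repr (K :* g)%g) (mem (coset_reps K))) => /=.
  rewrite -sumrMnl; apply: eq_bigr => t Tt.
  rewrite -(card_rcoset K t) -sumr_const; apply: eq_big => g.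
    exact: coset_reps_fiber.
  rewrite coset_reps_fiber // => /rcosetP[k Kk ->].
  by rewrite fK // (coset_reps_sub Tt).
by move=> g Gg; apply: repr_coset_reps.
Qed.

Lemma sum_coset_reps_sub (V : nmodType) (K N : {group gT}) (f : gT -> V) :
    K \subset N -> N \subset G -> {in N & G, forall k g, f (k * g)%g = f g} ->
  \sum_(g in coset_reps K) f g = (\sum_(g in coset_reps N) f g) *+ #|N : K|%g.
Proof.
move=> sKN sNG fN; have sKG := fintype.subset_trans sKN sNG.
rewrite (partition_big (fun g => repr (N :* g)%g) (mem (coset_reps N))) => /=.
  rewrite -sumrMnl; apply: eq_bigr => t Tt.
  rewrite (eq_bigr (fun=> f t)) => [|g /andP[/coset_reps_sub Gg Dg]]; last first.
    have: g \in (N :* t)%g by rewrite -coset_reps_fiber // Gg.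
    by case/rcosetP=> k Nk ->; rewrite fN // (coset_reps_sub Tt).
  rewrite sumr_const; congr (_ *+ _); apply/eqP.
  (* The coset N t contains |N : K| representatives modulo K: multiply by |K| and apply
     [sum_coset_reps] to the indicator function of N t. *)
  rewrite -(eqn_pmul2r (cardG_gt0 K)) [X in _ == X]mulnC Lagrange //.
  have sub k g : k \in K -> g \in G ->
      (repr (N :* (k * g))%g == t) = (repr (N :* g)%g == t).
    by move=> Kk _; rewrite rcosetM (rcoset_id (fintype.subsetP sKN k Kk)).
  have /= := @sum_coset_reps nat K (fun g => (repr (N :* g)%g == t) : nat) sKG.
  rewrite -mulr_natr natn => /(_ (fun k g Kk Gg => congr1 nat_of_bool (sub k g Kk Gg))).
  have cond (A : {set gT}) : (\sum_(g in A) (repr (N :* g)%g == t : nat)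
      = #|[pred g | (g \in A) && (repr (N :* g)%g == t)]|)%N.
    by rewrite -sum1_card big_mkcondr.
  rewrite !cond => cardE; apply/eqP/(etrans (esym cardE)).
  rewrite -(card_rcoset N t); apply: eq_card => g.
  exact: (coset_reps_fiber g sNG Tt).
by move=> g /coset_reps_sub Gg; apply: repr_coset_reps.
Qed.

Lemma coset_reps1 : coset_reps 1%g = G.
Proof. by apply/setP=> x; rewrite inE mul1g repr_set1 eqxx andbT. Qed.

End CosetTransversal.

(** * Integral combinations of group elements *)

Section IntegralCombinations.

Variables (gT : finGroupType) (G : {group gT}).

(** The action of the integral group ring. Integer coefficients let one z act on representations
    over the rationals and over F_p alike. *)
Definition zop (F : fieldType) n (rG : mx_representation F G n) (z : gT -> int) :=
  \sum_(g in G) rG g *~ z g.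

Definition lies_over (F : fieldType) n (rG : mx_representation rat G n)
    (P : set 'M[rat]_n) m (sG : mx_representation F G m) :=
  forall z : gT -> int, P (zop rG z) -> zop sG z = 0.

(** Families in which group elements repeat, such as all commutators, become coefficient functions
    by collecting equal terms. *)
Lemma zop_family (L : finType) (Q : pred L) (c : L -> int) (e : L -> gT)
    (F : fieldType) n (rG : mx_representation F G n) :
    (forall k, Q k -> e k \in G) ->
  zop rG (fun g => \sum_(k | Q k && (e k == g)) c k)
    = \sum_(k | Q k) rG (e k) *~ c k.
Proof.
move=> eG; rewrite (partition_big e (mem G)) //; apply: eq_bigr => g Gg.
by rewrite mulrz_sumr; apply: eq_bigr => k /andP[_ /eqP->].
Qed.

End IntegralCombinations.

(** * Commutator sums and the number omega *)

Section Commutators.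

Variables (F : fieldType) (gT : finGroupType) (G N : {group gT}) (n : nat).
Variable sG : mx_representation F G n.
Hypotheses (nNG : (N <| G)%g) (kN : N \subset rker sG).

Lemma repr_coset_eq x y :
  x \in G -> y \in G -> coset N x = coset N y -> sG x = sG y.
Proof.
have nNG' := normal_norm nNG; move=> Gx Gy eqxy.
by rewrite -(quo_repr_coset kN nNG') // -(quo_repr_coset kN nNG') // eqxy.
Qed.

Lemma repr_mulg_ker : {in N & G, forall k g, sG (k * g)%g = sG g}.
Proof.
by move=> k g /(fintype.subsetP kN)/rkerP[Gk rk] Gg; rewrite repr_mxM // rk mul1mx.
Qed.

Lemma repr_commg_ker k k' g h : k \in N -> k' \in N -> g \in G -> h \in G ->
  sG [~ k * g, k' * h]%g = sG [~ g, h]%g.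
Proof.
move=> Nk Nk' Gg Gh; have sNG := fintype.subsetP (normal_sub nNG).
have nN := fintype.subsetP (normal_norm nNG).
have [Gk Gk'] := (sNG k Nk, sNG k' Nk').
have [Gkg Gkh] := (groupM Gk Gg, groupM Gk' Gh).
apply: repr_coset_eq; [exact: groupR | exact: groupR |].
rewrite !morphR ?nN // !morphM ?nN //.
by rewrite /= (coset_id Nk) (coset_id Nk') !mul1g.
Qed.

(** Each of the two summations contributes a factor |N : K|. The case K = 1 compares with sums over
    all of G; the case of the kernels of rho and sigma yields the squared index. *)
Lemma commutator_reps_sub (K : {group gT}) : K \subset N ->
  \sum_(g in coset_reps G K) \sum_(h in coset_reps G K) sG [~ g, h]%g
    = (\sum_(g in coset_reps G N) \sum_(h in coset_reps G N) sG [~ g, h]%g)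
        *+ #|N : K|%g *+ #|N : K|%g.
Proof.
move=> sKN; have sNG := normal_sub nNG.
rewrite (@sum_coset_reps_sub _ _ _ K N) // => [|k g Nk Gg /=]; last first.
  apply: eq_bigr => h /coset_reps_sub Gh.
  by rewrite -{1}[h]mul1g repr_commg_ker.
congr (_ *+ _); rewrite -sumrMnl; apply: eq_bigr => g /coset_reps_sub Gg.
apply: (@sum_coset_reps_sub _ _ _ K N) => // k h Nk Gh /=.
by rewrite -{1}[g]mul1g repr_commg_ker.
Qed.

End Commutators.

Section Omega.

Variables (gT : finGroupType) (G : {group gT}) (n : nat).
Variable rG : mx_representation rat G n.
Hypothesis irrG : mx_irreducible rG.

Local Notation rC := (map_repr (ratr : rat -> algC) rG).
Local Notation theta := (cfRepr rC).

(** Both sides commute with rG(G), so by [constt_faithful] they may be compared on the constituent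
    ['Chi_i]. *)
Lemma commutator_sum_rat i : i \in irr_constt theta ->
  \sum_(g in G) \sum_(h in G) rG [~ g, h]%g
    = ((#|G|%:R / (irr_degree (socle_of_Iirr i))%:R) ^+ 2)%:M.
Proof.
move=> ci; have [B homB freeB] := constt_intertwiner ci.
have nzB := row_free_neq0 (irr_degree_gt0 _) freeB.
apply/eqP; rewrite -subr_eq0; apply/eqP.
apply: (constt_faithful irrG nzB).
  apply/centgmxP=> x Gx; rewrite mulmxBl mulmxBr scalar_mxC; congr (_ - _).
  rewrite mulmx_suml mulmx_sumr (reindex_inj (conjg_inj x^-1%g)) /=.
  apply: eq_big => [g | g]; rewrite groupJr ?groupV // => Gg.
  rewrite mulmx_suml mulmx_sumr (reindex_inj (conjg_inj x^-1%g)) /=.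
  apply: eq_big => [h | h]; rewrite groupJr ?groupV // => Gh.
  rewrite -!repr_mxM ?groupR ?groupJ ?groupV //; congr (rG _).
  by rewrite -conjRg conjgE invgK -!mulgA mulVg mulg1.
rewrite map_mxB mulmxBr; apply/eqP; rewrite subr_eq0; apply/eqP.
transitivity ((\sum_(g in G) \sum_(h in G) 'Chi_i [~ g, h]%g) *m B).
  rewrite raddf_sum mulmx_suml mulmx_sumr; apply: eq_bigr => g Gg.
  rewrite /= raddf_sum mulmx_suml mulmx_sumr; apply: eq_bigr => h Gh.
  by rewrite homB // groupR.
rewrite commutator_sum_irr map_scalar_mx mul_scalar_mx mul_mx_scalar.
by rewrite rmorphXn fmorph_div !rmorph_nat.
Qed.

(* [commutator_sum_rat] computes one rational scalar from every constituent. *)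
Lemma constt_degree_eq i :
  i \in irr_constt theta -> irr_degree (socle_of_Iirr i) = constt_degree rG.
Proof.
move=> ci; have [j cj ->] := constt_degreeP irrG.
have := commutator_sum_rat ci; rewrite (commutator_sum_rat cj).
have /prednK <- := irr_repr_dim_gt0 irrG.
move/(congr1 (fun A : 'M_ _.+1 => A 0 0)); rewrite !mxE !mulr1n => /eqP.
rewrite eqrXn2 ?divr_ge0 ?ler0n // => /eqP/mulfI eq_inv.
have /invr_inj/eqP := eq_inv (natrG_neq0 _ _).
by rewrite eqr_nat => /eqP.
Qed.

(** The kernel lies in the center Z(chi) of a constituent chi, whose degree divides |G : Z(chi)|;
    hence the division defining omega is exact. *)
Lemma repr_omegaM : (repr_omega rG * (#|rker rG| * constt_degree rG) = #|G|)%N.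
Proof.
have [i ci Di] := constt_degreeP irrG.
have sKZ : rker rG \subset 'Z('chi_i)%CF.
  apply: fintype.subset_trans (normal_sub (cfker_center_normal _)).
  have := cfker_constt (cfRepr_char rC) ci.
  by rewrite cfker_repr rker_map.
have sKG : rker rG \subset G by apply: rstab_sub.
have sZG : 'Z('chi_i)%CF \subset G by apply: cfcenter_sub.
have := dvd_irr1_index_center i; rewrite irr1_degree dvdC_nat -Di => dvd_d.
rewrite /repr_omega divnK // -(Lagrange sKG) dvdn_pmul2l ?cardG_gt0 //.
by rewrite -(Lagrange_index sZG sKZ) dvdn_mulr.
Qed.

Lemma commutator_reps_sum :
  \sum_(g in coset_reps G (rker rG)) \sum_(h in coset_reps G (rker rG))
     rG [~ g, h]%g = ((repr_omega rG)%:R ^+ 2)%:M.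
Proof.
have [i ci Di] := constt_degreeP irrG.
have := commutator_sum_rat ci; rewrite -Di -repr_omegaM.
have nKG : (rker rG <| G)%g by apply: rker_normal.
have := commutator_reps_sub nKG (subxx _) (sub1G _).
rewrite coset_reps1 indexg1 => -> sumE.
have k_neq0 : (#|rker rG|%:R : rat) != 0 by apply: (natrG_neq0 _ [group of rker rG]).
have d_neq0 : ((constt_degree rG)%:R : rat) != 0.
  by rewrite Di pnatr_eq0 -lt0n irr_degree_gt0.
apply: (scalerI (mulf_neq0 k_neq0 k_neq0)).
rewrite -scalerA !scaler_nat sumE scale_scalar_mx !natrM; congr _%:M.
by field.
Qed.

End Omega.

(** * Lifting elements of the ring of integers *)

Section IntegerLift.

Variables (gT : finGroupType) (G : {group gT}) (n : nat).
Variable rG : mx_representation rat G n.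
Hypothesis irrG : mx_irreducible rG.

Local Notation toC := (map_mx (ratr : rat -> algC)).
Local Notation rC := (map_repr (ratr : rat -> algC) rG).
Local Notation theta := (cfRepr rC).

(* On a constituent chi of degree d and multiplicity m this acts as m |G| / d, which
   removes the multiplicity (the Schur index) from trace coefficients. *)
Definition trace_casimir : 'M[rat]_n := \sum_(g in G) \tr (rG g) *: rG g^-1%g.

Lemma trace_casimir_center : repr_center rG trace_casimir.
Proof.
split.
  apply/centgmxP=> x Gx; rewrite mulmx_suml mulmx_sumr.
  rewrite (reindex_inj (conjg_inj x^-1%g)) /=.
  apply: eq_big => [g | g]; rewrite groupJr ?groupV // => Gg.
  rewrite -scalemxAl -scalemxAr -!repr_mxM ?groupV ?groupJ ?groupV //.
  congr (_ *: rG _); last by rewrite -conjVg conjgE invgK -!mulgA mulVg mulg1.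
  rewrite conjgE invgK !repr_mxM ?groupM ?groupV // mxtrace_mulC -mulmxA.
  by rewrite -repr_mxM ?groupV // mulVg repr_mx1 mulmx1.
move=> B /centgmxP cB; rewrite mulr_sumr mulr_suml.
apply: eq_bigr => g Gg.
by rewrite -[LHS]scalemxAl -[RHS]scalemxAr -cB ?groupV.
Qed.

(** By linearity A may be taken to be rG(h), where the substitution of g^-1 h for g gives the claim.
    Traces thereby supply group ring coefficients. *)
Lemma trace_casimir_expand A : (A \in enveloping_algebra_mx rG)%MS ->
  \sum_(g in G) \tr (A *m rG g^-1%g) *: rG g = trace_casimir *m A.
Proof.
case/envelop_mxP=> a ->; rewrite mulmx_sumr.
under eq_bigr => g Gg do rewrite mulmx_suml raddf_sum scaler_suml.
rewrite exchange_big; apply: eq_bigr => h Gh /=.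
rewrite -scalemxAr mulmx_suml scaler_sumr (reindex_inj invg_inj) /=.
rewrite (reindex_inj (mulgI h^-1%g)) /=.
apply: eq_big => [g | g]; first by rewrite groupV groupMl ?groupV.
rewrite groupV groupMl ?groupV // => Gg.
rewrite !invMg !invgK -!scalemxAl mxtraceZ -scalerA -!repr_mxM ?groupM ?groupV //.
by rewrite mulKVg.
Qed.

Lemma trace_casimir_eigen i B : intertwines 'Chi_i rC B ->
  B *m toC trace_casimir
    = (#|G|%:R * '[theta, 'chi_i] / (irr_degree (socle_of_Iirr i))%:R) *: B.
Proof.
move=> homB; rewrite -[X in '[_, X]]irrRepr -mul_scalar_mx.
rewrite -cfun_irr_scalar; last exact: socle_irr.
rewrite raddf_sum mulmx_sumr mulmx_suml; apply: eq_bigr => g Gg.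
rewrite /= map_mxZ -scalemxAl -scalemxAr homB ?groupV //; congr (_ *: _).
by rewrite cfunE Gg mulr1n trace_map_mx.
Qed.

Lemma trace_casimir_unit : trace_casimir \in unitmx.
Proof.
apply: (mx_Schur irrG trace_casimir_center.1); apply/eqP=> c0.
have [i [ci _ [B homB freeB]]] := irr_intertwiner irrG.
have nzB := row_free_neq0 (irr_degree_gt0 _) freeB.
have := trace_casimir_eigen homB; rewrite c0 map_mx0 mulmx0 => /esym/eqP.
rewrite scalemx_eq0 (negPf nzB) orbF mulf_eq0 invr_eq0 pnatr_eq0 eqn0Ngt.
rewrite irr_degree_gt0 orbF mulf_eq0 (negPf (neq0CG G)) /=.
by move: ci; rewrite irr_consttE => /negPf->.
Qed.

Lemma trace_casimir_div A : repr_center rG A ->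
  exists2 B, repr_center rG B & trace_casimir *m B = A.
Proof.
move=> [/centgmxP eA cA]; have [/centgmxP eC cC] := trace_casimir_center.
exists (invmx trace_casimir *m A); last by rewrite mulKVmx // trace_casimir_unit.
have uC := trace_casimir_unit.
have invC B : trace_casimir *m B = B *m trace_casimir ->
    invmx trace_casimir *m B = B *m invmx trace_casimir.
  move=> cB; apply: (can_inj (mulKmx uC)); rewrite mulKVmx // mulmxA cB.
  by rewrite mulmxK.
split=> [|B eB].
  by apply/centgmxP=> x Gx; rewrite -mulmxA eA // mulmxA (invC (rG x)) ?eC // -mulmxA.
have eqAB : A *m B = B *m A := cA B eB.
rewrite -[LHS]mulmxA eqAB [LHS]mulmxA (invC B (cC B eB)).
by rewrite -[LHS]mulmxA.
Qed.

(** On a constituent chi of multiplicity m and degree d one has lA = (|G| m / d) lB, hence omega k m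
    lB = lA with k the order of the kernel. The number is therefore the sum of the lA chi(g), a
    rational algebraic integer. *)
Lemma trace_coef_int A B g :
    repr_integers rG A -> repr_center rG B -> trace_casimir *m B = A ->
    g \in G ->
  exists z : int, (repr_omega rG * #|rker rG|)%:R * \tr (B *m rG g) = z%:~R.
Proof.
move=> [cA iA] cB DA Gg.
have [lB [lBE trB]] := center_scalars irrG cB.
have [lA [lAE _]] := center_scalars irrG cA.
set x := _ * _; suff: (ratr x : algC) \in Num.int.
  case/Num.Theory.intrP=> z zE; exists z.
  by apply: (fmorph_inj (ratr : {rmorphism rat -> algC})); rewrite /= ratr_int -zE.
apply: Cint_rat_Aint; first exact: Crat_rat.
have d_neq0 : ((constt_degree rG)%:R : algC) != 0.
  by have [i _ ->] := constt_degreeP irrG; rewrite pnatr_eq0 -lt0n irr_degree_gt0.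
rewrite rmorphM /= trB // rmorph_nat mulr_sumr rpred_sum // => i ci.
suff -> : (repr_omega rG * #|rker rG|)%:R * ('[theta, 'chi_i] * lB i * 'chi_i g)
    = lA i * 'chi_i g.
  have [C homC freeC] := constt_intertwiner ci.
  have nzC := row_free_neq0 (irr_degree_gt0 _) freeC.
  have lAi : lA i \in Aint := (integral_eltP irrG nzC cA.1 (lAE i C ci homC)).1 iA.
  by rewrite rpredM // Aint_irr.
rewrite mulrA; congr (_ * _).
have [C homC freeC] := constt_intertwiner ci.
have nzC := row_free_neq0 (irr_degree_gt0 _) freeC.
apply/eqP; rewrite -subr_eq0 -[_ == 0]orbF -[X in _ || X](negPf nzC) -scalemx_eq0.
rewrite scalerBl -(lAE i C) // -DA map_mxM mulmxA trace_casimir_eigen //.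
rewrite -scalemxAl lBE // scalerA subr_eq0; apply/eqP; congr (_ *: _).
move: (cfdot _ _) => m; rewrite (constt_degree_eq irrG ci) -(repr_omegaM irrG) !natrM.
by field.
Qed.

Lemma integer_lift A : repr_integers rG A ->
  exists2 z : gT -> int, zop rG z = A *+ repr_omega rG
    & forall m (sG : mx_representation rat G m), mx_irreducible sG ->
        ~ mx_rsim rG sG -> rker rG \subset rker sG -> zop sG z = 0.
Proof.
move=> iA; have [B cB DA] := trace_casimir_div iA.1.
have /choice[v vE] g : exists z : int, g \in G ->
    (repr_omega rG * #|rker rG|)%:R * \tr (B *m rG g^-1%g) = z%:~R.
  have [Gg | _] := boolP (g \in G); last by exists 0.
  have [|z zE] := trace_coef_int iA cB DA (_ : g^-1%g \in G); first by rewrite groupV.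
  by exists z.
set T := coset_reps G (rker rG).
(* Restricting the coefficients to representatives absorbs the factor k = |ker rG|, provided [sG] is
   constant on cosets of this kernel. The full sum is then given by [trace_casimir_expand] for rG
   itself and by orthogonality for other irreducibles. *)
pose z g := if g \in T then v g else 0.
have zE m (sG : mx_representation rat G m) : rker rG \subset rker sG ->
    zop sG z = (\sum_(g in G) \tr (B *m rG g^-1%g) *: sG g) *+ repr_omega rG.
  move=> sK.
  rewrite (@sum_coset_reps _ _ _ [group of rker rG]); first 1 last.
  - exact: rstab_sub.
  - move=> k g Kk Gg; have /rkerP[Gk rk] : k^-1%g \in rker rG by rewrite groupV.
    have Gk0 : k \in G by rewrite -groupV.
    by rewrite (repr_mulg_ker sK) // invMg repr_mxM ?groupV // rk mulmx1.
  rewrite -mulrnA mulnC -scaler_nat scaler_sumr /zop big_mkcond [RHS]big_mkcond.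
  apply: eq_bigr => g _; rewrite /z -/T.
  have [Tg | nTg] := boolP (g \in T); last by rewrite mulr0z if_same.
  have Gg := coset_reps_sub Tg; rewrite Gg scalerA vE //.
  by rewrite scaler_int.
exists z; first by rewrite zE // trace_casimir_expand ?DA ?repr_center_envelop.
by move=> m sG irrS nsim sK; rewrite zE // irr_orthogonal // mul0rn.
Qed.

End IntegerLift.

(** * Modular representations over a prime ideal *)

(* The determinant trick, done by eliminating one generator at a time so that no
   commutative ring structure is needed: s u_k = sum_l m_kl u_l with s in 1 + P. *)
Lemma nakayama_elimination (T : pzRingType) (P : set T) :
    P 0 -> (forall x, P x -> P (- x)) -> (forall x y, P x -> P y -> P (x + y)) ->
    (forall x y, P x -> P y -> P (x * y)) ->
    (forall x y, P x -> P y -> x * y = y * x) ->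
  forall (r : nat) (s : T) (u : nat -> T) (m : nat -> nat -> T),
    P (1 - s) -> (forall k l, P (m k l)) ->
    (forall k, (k < r)%N -> s * u k = \sum_(l < r) m k l * u l) ->
  exists2 s', P (1 - s') & forall k, (k < r)%N -> s' * u k = 0.
Proof.
move=> P0 PN PD PM Pcomm; have PB x y : P x -> P y -> P (x - y).
  by move=> Px Py; apply: PD (PN _ Py).
have unitPM s x : P (1 - s) -> P x -> P (s * x).
  move=> Ps Px; rewrite -[s](subKr 1) mulrBl mul1r.
  exact: PB (PM _ _ Ps Px).
have unitMcomm s x : P (1 - s) -> P x -> s * x = x * s.
  move=> Ps Px; rewrite -[s](subKr 1) mulrBl mulrBr mul1r mulr1.
  by rewrite (Pcomm x).
have unitM s t : P (1 - s) -> P (1 - t) -> P (1 - s * t).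
  move=> Ps Pt; have -> : 1 - s * t = (1 - s) + s * (1 - t).
    by rewrite mulrBr mulr1 addrA subrK.
  by apply: PD => //; apply: unitPM.
elim=> [|r IHr] s u m Ps Pm eq_u; first by exists 1; rewrite ?subrr.
(* The last relation becomes t u_r = sum over l < r of m_rl u_l. Multiplying the other relations by
   t allows u_r to be substituted away. *)
pose t := s - m r r; have Pt : P (1 - t).
  by rewrite /t opprB addrCA addrC; apply: PD.
have t_ur : t * u r = \sum_(l < r) m r l * u l.
  by rewrite mulrBl eq_u // big_ord_recr /= addrK.
have [||k ltkr|s' Ps' s'u] := IHr (t * s) u (fun k l => t * m k l + m k r * m r l).
- exact: unitM.
- by move=> k l; apply: PD; [apply: unitPM | apply: PM].
- rewrite -mulrA eq_u ?(ltn_trans ltkr) // big_ord_recr /= mulrDr.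
  rewrite mulr_sumr mulrA (unitMcomm t) // -mulrA t_ur mulr_sumr -big_split /=.
  by apply: eq_bigr => l _; rewrite [RHS]mulrDl !mulrA.
exists (s' * t) => [|k]; first exact: unitM.
rewrite ltnS leq_eqVlt => /orP[/eqP-> | ltkr].
  rewrite -mulrA t_ur mulr_sumr big1 // => l _.
  by rewrite mulrA (unitMcomm s') // -mulrA s'u ?mulr0.
have -> : s' * t = t * s'.
  have := unitMcomm _ _ Pt Ps'; rewrite [LHS]mulrBr mulr1 [RHS]mulrBl mul1r.
  by move/addrI/oppr_inj.
by rewrite -mulrA s'u ?mulr0.
Qed.

Section RegularQuotient.

Variables (F : fieldType) (gT : finGroupType) (G : {group gT}).

Lemma regular_mulE (u : 'rV[F]_#|G|) g h : g \in G -> h \in G ->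
  (u *m regular_repr F G g) 0 (gring_index G h) = u 0 (gring_index G (h * g^-1)).
Proof.
move=> Gg Gh; have Gk : (h * g^-1)%g \in G by rewrite groupM ?groupV.
rewrite mxE (bigD1 (gring_index G (h * g^-1))) //= big1 => [|i ni].
  by rewrite !mxE !gring_indexK // mulgKV !eqxx mulr1 addr0.
rewrite !mxE eqxx /=; case: eqP => [/(congr1 enum_val)|]; last by rewrite mulr0.
rewrite !gring_indexK ?groupM ?enum_valP // => eq_h; case/eqP: ni.
by rewrite eq_h mulgK gring_valK.
Qed.

(* The second hypothesis says that the f_l do not generate the unit ideal of the
   group algebra. *)
Lemma irr_annihilated (L : finType) (f : L -> gT -> F) :
    (forall l x, x \in G ->
       exists l', {in G, forall g, f l' g = f l (x * g * x^-1)%g}) ->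
    (forall a : L -> gT -> F, ~ {in G, forall x,
       (x == 1%g)%:R = \sum_l \sum_(g in G) f l g * a l (x * g^-1)%g}) ->
  exists m (sG : mx_representation F G m),
    mx_irreducible sG /\ forall l, \sum_(g in G) f l g *: sG g = 0.
Proof.
move=> fJ f1; pose aG := regular_repr F G.
pose op l := \sum_(g in G) f l g *: aG g.
(* Row vectors are elements of the group algebra, so U is the left ideal generated by the f_l. The
   conjugation hypothesis makes it stable under right multiplication too. *)
pose U := (\sum_l op l)%MS.
have modU : mxmodule aG U.
  apply/mxmoduleP=> x Gx; rewrite sumsmxMr.
  apply/sumsmx_subP=> l _; have [l' fl'] := fJ l x Gx.
  apply: (sumsmx_sup l') => //; apply/submxP; exists (aG x).
  rewrite /op mulmx_suml mulmx_sumr (reindex_inj (conjg_inj x^-1%g)) /=.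
  apply: eq_big => [g | g]; rewrite groupJr ?groupV // => Gg.
  rewrite -scalemxAl -scalemxAr fl' // conjgE invgK mulgA; congr (_ *: _).
  by rewrite -!repr_mxM ?groupM ?groupV // mulgKV.
have ltU : cokermx U != 0.
  apply/eqP=> cok0; have: (gring_row (1%:M : 'M[F]_#|G|) <= U)%MS.
    by rewrite submxE cok0 mulmx0.
  case/sub_sumsmxP=> u uE; apply: (f1 (fun l x => u l 0 (gring_index G x))) => x Gx.
  transitivity ((gring_row (1%:M : 'M[F]_#|G|)) 0 (gring_index G x)).
    rewrite !mxE; congr (nat_of_bool _)%:R; apply/eqP/eqP=> [-> //|].
    by move/(congr1 enum_val); rewrite !gring_indexK.
  rewrite uE summxE; apply: eq_bigr => l _.
  rewrite mulmx_sumr summxE; apply: eq_bigr => g Gg.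
  by rewrite -scalemxAr mxE regular_mulE.
pose rQ := factmod_repr modU.
have Q1 : (1%:M : 'M[F]_(\rank (cokermx U))) != 0.
  by rewrite -mxrank_eq0 mxrank1 mxrank_eq0.
(* A simple submodule of the nonzero quotient by U; each f_l acts on it as zero because U contains
   the row space of [op l]. *)
have [V simV _] : exists2 V, mxsimple rQ V & (V <= 1%:M)%MS.
  apply/asboolP/(mxsimple_exists (mxmodule1 rQ) Q1) => -[V simV sV].
  by apply/asboolP; exists V.
have modV := mxsimple_module simV.
exists (\rank V), (submod_repr modV); split=> [|l]; first exact/submod_mx_irr.
transitivity (in_submod V
  (val_submod (1%:M : 'M_(\rank V)) *m \sum_(g in G) f l g *: rQ g)).
  rewrite mulmx_sumr raddf_sum; apply: eq_bigr => g Gg /=.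
  by rewrite -scalemxAr linearZ.
suff -> : \sum_(g in G) f l g *: rQ g = 0 by rewrite mulmx0 raddf0.
transitivity (in_factmod U (val_factmod (1%:M : 'M_(\rank (cokermx U))) *m op l)).
  rewrite mulmx_sumr raddf_sum; apply: eq_bigr => g Gg /=.
  by rewrite -scalemxAr linearZ.
apply/eqP; rewrite in_factmod_eq0; apply: submx_trans (submxMl _ _) _.
by apply: (sumsmx_sup l).
Qed.

End RegularQuotient.

Lemma Fp_intr_eq0 (p : nat) (z : int) :
  prime p -> z%:~R = 0 :> 'F_p -> exists y, z = y * p%:Z.
Proof.
move=> p_pr /eqP; rewrite -(dvdz_pcharf (pchar_Fp p_pr)) => /dvdzP[y ->].
by exists y.
Qed.

Section PrimeIdeals.

Variables (gT : finGroupType) (G : {group gT}) (n : nat).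
Variable rG : mx_representation rat G n.
Hypothesis irrG : mx_irreducible rG.
Variable P : set 'M[rat]_n.
Hypothesis primeP : is_prime_ideal (repr_integers rG) P.

Lemma prime_ideal_sub A : P A -> repr_integers rG A.
Proof. by case: primeP => -[sPO _ _ _] _ _; apply: sPO. Qed.

Lemma prime_ideal0 : P 0.
Proof. by case: primeP => -[]. Qed.

Lemma prime_idealD A B : P A -> P B -> P (A + B).
Proof. by case: primeP => -[_ _ PD _] _ _; apply: PD. Qed.

Lemma prime_idealMl A B : repr_integers rG A -> P B -> P (A * B).
Proof. by case: primeP => -[_ _ _ PM] _ _; apply: PM. Qed.

Lemma prime_idealMz A z : P A -> P (A *~ z).
Proof. by rewrite -mulrzl; apply: prime_idealMl (repr_integers_intr irrG z). Qed.

Lemma prime_idealN A : P A -> P (- A).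
Proof. by rewrite -mulrN1z; apply: prime_idealMz. Qed.

Lemma prime_ideal_sum (L : finType) (Q : pred L) (A : L -> 'M_n) :
  (forall l, Q l -> P (A l)) -> P (\sum_(l | Q l) A l).
Proof.
by move=> PA; apply: big_ind => //; [apply: prime_ideal0 | apply: prime_idealD].
Qed.

Lemma prime_ideal_comm A g : P A -> g \in G -> A * rG g = rG g * A.
Proof. by move=> /prime_ideal_sub[[/centgmxP cA _] _] /cA. Qed.

(** Multiplying such an equation by each rG(x) expresses all the rG(x) through one another with
    coefficients in P. Elimination then gives s' in 1 + P with s' rG(1) = 0, so 1 would lie in P. *)
Lemma prime_ideal_expand (m : gT -> 'M_n) :
  (forall g, P (m g)) -> 1 <> \sum_(g in G) m g * rG g.
Proof.
move=> Pm eq1; have [_ nP1 _] := primeP; apply: nP1.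
pose e k := nth 1%g (enum G) k.
have eG k : (k < #|G|)%N -> e k \in G.
  by move=> ltk; rewrite -mem_enum mem_nth // -cardE.
have PM A B : P A -> P B -> P (A * B) by move/prime_ideal_sub/prime_idealMl; apply.
have Pcomm A B : P A -> P B -> A * B = B * A.
  by move=> /prime_ideal_sub[[eA _] _] /prime_ideal_sub[[_ cB] _]; rewrite cB.
have [||k ltk|s' Ps' s'u] := @nakayama_elimination _ P prime_ideal0 prime_idealN
    prime_idealD PM Pcomm #|G| 1 (rG \o e) (fun k l => m (e l * (e k)^-1)%g).
- by rewrite subrr; apply: prime_ideal0.
- by move=> k l; apply: Pm.
- rewrite /= {1}eq1 mulr_suml.
  rewrite -(big_mkord xpredT (fun l => m (e l * (e k)^-1)%g * rG (e l))).
  rewrite cardE -(big_nth _ xpredT (fun h => m (h * (e k)^-1)%g * rG h)) big_enum /=.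
  rewrite [RHS](reindex_inj (mulIg (e k))) /=; apply: eq_big => g.
    by rewrite groupMr ?eG.
  by move=> Gg; rewrite mulgK repr_mxM ?eG // mulrA.
have /(s'u _) : (index 1%g (enum G) < #|G|)%N by rewrite cardE index_mem mem_enum.
rewrite /= /e nth_index ?mem_enum // repr_mx1 [_ * _]mulmx1 => s'0.
by rewrite s'0 subr0 in Ps'.
Qed.

Lemma zop_conj z x : x \in G -> repr_center rG (zop rG z) ->
  zop rG (fun g => z (x * g * x^-1)%g) = zop rG z.
Proof.
move=> Gx [/centgmxP cz _]; apply: (can_inj (repr_mxKV rG Gx)).
rewrite cz ?groupV // /zop mulmx_suml mulmx_sumr (reindex_inj (conjg_inj x)) /=.
apply: eq_big => [g | g]; rewrite groupJr // => Gg.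
rewrite conjgE -!mulgA mulKVg mulgV mulg1 -!scaler_int -scalemxAl -scalemxAr.
by rewrite -!repr_mxM ?groupM ?groupV // -!mulgA mulgV mulg1.
Qed.

(** [sG] is chosen to annihilate the reductions mod p of all combinations that rG maps into P. If
    these generated the unit ideal, lifting to Z would contradict [prime_ideal_expand]. *)
Lemma exists_lies_over (p : nat) : prime p -> P p%:R ->
  exists m (sG : mx_representation 'F_p G m),
    mx_irreducible sG /\ lies_over rG P sG.
Proof.
move=> p_pr Pp; pose L := {ffun gT -> 'F_p}.
pose Q (l : L) := exists2 z, P (zop rG z) & forall g, l g = (z g)%:~R.
(* A finite index type is required, so l runs over all functions to F_p, and those that are not such
   reductions are replaced by 0. *)
pose f (l : L) g := if `[< Q l >] then l g else 0.
have [||m [sG [irrS sG0]]] := @irr_annihilated 'F_p gT G L f.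
- move=> l x Gx; have [Ql | nQl] := pselect (Q l); last first.
    by exists l => g _; rewrite /f asboolF.
  pose l' : L := [ffun g => l (x * g * x^-1)%g].
  have Ql' : Q l'.
    have [z Pz zE] := Ql; exists (fun g => z (x * g * x^-1)%g).
      by rewrite zop_conj //; case: (prime_ideal_sub Pz).
    by move=> g; rewrite ffunE zE.
  by exists l' => g _; rewrite /f !asboolT // ffunE.
- move=> a aE.
  have /choice[z zE] l : exists z, P (zop rG z) /\ forall g, f l g = (z g)%:~R.
    have [[z Pz zE] | nQl] := pselect (Q l).
      by exists z; split=> // g; rewrite /f asboolT //; exists z.
    exists (fun=> 0); split=> [|g]; last by rewrite /f asboolF.
    rewrite /zop big1 => [|g _]; [exact: prime_ideal0 | exact: mulr0z].
  (* Lifting coefficients to integers leaves an error divisible by p, with quotient [y] below; as p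
     is in P, the error too has coefficients in P. *)
  pose al l h : int := (a l h : nat)%:Z.
  have /choice[y yE] x : exists y, x \in G ->
      (x == 1%g)%:Z = \sum_l \sum_(g in G) z l g * al l (x * g^-1)%g + y * p%:Z.
    have [Gx | _] := boolP (x \in G); last by exists 0.
    have [|y yE] := @Fp_intr_eq0 p ((x == 1%g)%:Z
        - \sum_l \sum_(g in G) z l g * al l (x * g^-1)%g) p_pr.
      rewrite rmorphB /= -pmulrn aE // rmorph_sum; apply/eqP; rewrite subr_eq0.
      apply/eqP/eq_bigr => l _; rewrite rmorph_sum; apply: eq_bigr => g _ /=.
      by rewrite rmorphM /= -(zE l).2 -pmulrn natr_Zp.
    by exists y => _; rewrite -yE addrC subrK.
  pose m x := \sum_l zop rG (z l) *~ al l x + p%:R *~ y x.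
  apply: (@prime_ideal_expand m) => [x|].
    apply: prime_idealD; last exact: prime_idealMz.
    by apply: prime_ideal_sum => l _; apply: prime_idealMz; case: (zE l).
  transitivity (\sum_(x in G) rG x *~ (x == 1%g)%:Z).
    rewrite (bigD1 1%g) //= eqxx repr_mx1 big1 ?addr0 // => x /andP[_ /negPf->].
    by rewrite mulr0z.
  under eq_bigr => x Gx do rewrite yE // mulrzDr.
  rewrite big_split /m; under [RHS]eq_bigr do rewrite mulrDl.
  rewrite big_split /=; congr (_ + _); last first.
    apply: eq_bigr => x _; rewrite [RHS]mulrzAl mulr_natl mulrC.
    by rewrite [RHS](_ : _ = rG x *~ p%:Z *~ y x) // -mulrzA.
  under eq_bigr do rewrite mulrz_sumr.
  under [RHS]eq_bigr do rewrite mulr_suml.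
  rewrite exchange_big [RHS]exchange_big; apply: eq_bigr => l _ /=.
  under eq_bigr do rewrite mulrz_sumr.
  rewrite exchange_big /=.
  under [RHS]eq_bigr => x Gx do
    rewrite mulrzAl (prime_ideal_comm (zE l).1 Gx) /zop mulr_sumr mulrz_suml.
  rewrite [RHS]exchange_big /=; apply: eq_bigr => g Gg.
  rewrite (reindex_inj (mulIg g)) /=; apply: eq_big => h; first by rewrite groupMr.
  rewrite groupMr // => Gh; rewrite mulgK mulrzA mulrzAr repr_mxM //.
exists m, sG; split=> // z Pz; pose l : L := [ffun g => (z g)%:~R].
have Ql : Q l by exists z => // g; rewrite ffunE.
rewrite -[RHS](sG0 l); apply: eq_bigr => g _.
by rewrite /f asboolT // ffunE scaler_int.
Qed.

End PrimeIdeals.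

(** * Recovering the rational representation and the prime ideal *)

Section ZopLinear.

Variables (F : fieldType) (gT : finGroupType) (G : {group gT}) (n : nat).
Variable rG : mx_representation F G n.

Lemma zopD z z' : zop rG (fun g => z g + z' g) = zop rG z + zop rG z'.
Proof.
by rewrite /zop -big_split; apply: eq_bigr => g _; rewrite mulrzDr.
Qed.

Lemma zop_scalar (c : int) :
  zop rG (fun g => if g == 1%g then c else 0) = (c%:~R)%:M.
Proof.
rewrite /zop (bigD1 1%g) //= eqxx repr_mx1 big1 => [|g /andP[_ /negPf->]].
  by rewrite addr0 -scaler_int scalemx1.
by rewrite mulr0z.
Qed.

End ZopLinear.

Section LiesOver.

Variables (gT : finGroupType) (G : {group gT}) (p : nat) (m : nat).
Hypothesis p_pr : prime p.
Variable sG : mx_representation 'F_p G m.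
Hypothesis irrS : mx_irreducible sG.

Section OnePrime.

Variables (n : nat) (rG : mx_representation rat G n) (P : set 'M[rat]_n).
Hypothesis irrG : mx_irreducible rG.
Hypothesis primeP : is_prime_ideal (repr_integers rG) P.
Hypothesis overP : lies_over rG P sG.
Hypothesis p'omega : ~~ (p %| repr_omega rG)%N.

Lemma Fp_scalar_eq0 (c : int) : ((c%:~R)%:M : 'M['F_p]_m) = 0 -> exists y, c = y * p%:Z.
Proof.
have [m_gt0 _] := (mx_irrP _).1 irrS; move/matrixP/(_ (Ordinal m_gt0) (Ordinal m_gt0)).
by rewrite !mxE eqxx mulr1n; apply: Fp_intr_eq0.
Qed.

(** Subtracting c at the identity gives a combination with image 0, which belongs to P. *)
Lemma lies_over_scalar z (c : int) :
  zop rG z = (c%:~R)%:M -> zop sG z = (c%:~R)%:M.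
Proof.
move=> zc; have := overP (z := fun g => z g + if g == 1%g then - c else 0).
rewrite !zopD !zop_scalar zc !mulrNz !raddfN /= subrr => z0.
by apply/eqP; rewrite -subr_eq0 z0 //; apply: prime_ideal0 primeP.
Qed.

Lemma lies_over_sum (L : finType) (Q : pred L) (e : L -> gT) (c : int) :
    (forall k, Q k -> e k \in G) -> \sum_(k | Q k) rG (e k) = (c%:~R)%:M ->
  \sum_(k | Q k) sG (e k) = (c%:~R)%:M.
Proof.
move=> eG sumE; pose z g : int := \sum_(k | Q k && (e k == g)) 1.
have zE (F : fieldType) k (tG : mx_representation F G k) :
    zop tG z = \sum_(k | Q k) tG (e k).
  by rewrite (@zop_family _ _ _ Q (fun=> 1)).
by rewrite -zE; apply: lies_over_scalar; rewrite zE.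
Qed.

Lemma rker_lies_over_sub : rker rG \subset rker sG.
Proof.
apply/fintype.subsetP=> k /rkerP[Gk rk]; apply/rkerP; split=> //.
have := @lies_over_sum unit xpredT (fun=> k) 1.
by rewrite !(big_pred1 tt) => [->|[]|[]].
Qed.

Lemma index_rker_lies_over : ~~ (p %| #|rker sG : rker rG|%g)%N.
Proof.
apply: contra p'omega => /dvdnP[q ind_pq].
have nNG : (rker sG <| G)%g by apply: rker_normal.
have := commutator_reps_sub nNG (subxx _) rker_lies_over_sub.
have -> : \sum_(g in coset_reps G (rker rG)) \sum_(h in coset_reps G (rker rG))
    sG [~ g, h]%g = (((repr_omega rG)%:Z ^+ 2)%:~R)%:M.
  rewrite pair_big; apply: lies_over_sum => [[g h] /= /andP[]|].
    by move=> /coset_reps_sub Gg /coset_reps_sub Gh; apply: groupR.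
  have := commutator_reps_sum irrG; rewrite pair_big => ->; congr _%:M.
  by rewrite rmorphXn.
have Fp0 : p%:R = 0 :> 'F_p by apply/eqP; rewrite -(dvdn_pcharf (pchar_Fp p_pr)).
rewrite ind_pq mulrnA -[_ *+ p]scaler_nat Fp0 scale0r => /Fp_scalar_eq0[y].
move/(congr1 absz); rewrite abszX abszM !absz_nat => omega2.
have : (p %| repr_omega rG ^ 2)%N by rewrite omega2 dvdn_mull.
by rewrite Euclid_dvdX // andbT.
Qed.

Lemma card_coset_reps_sub (N K : {group gT}) :
  K \subset N -> #|coset_reps N K| = #|N : K|%g.
Proof.
move=> sKN; apply/eqP; rewrite -(eqn_pmul2r (cardG_gt0 K)).
rewrite [X in _ == X]mulnC Lagrange //; apply/eqP.
have /= := @sum_coset_reps _ N nat K (fun=> 1%N) sKN (fun _ _ _ _ => erefl).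
by rewrite -mulr_natr natn !sum1_card => ->.
Qed.

Lemma rker_lies_over : rker sG = rker rG.
Proof.
apply/eqP; rewrite finset.eqEsubset rker_lies_over_sub andbT.
set N := rker sG; set K := rker rG.
have sNG : N \subset G by apply: rstab_sub.
have nNG : (N <| G)%g by apply: rker_normal.
have sKN : K \subset N := rker_lies_over_sub.
pose A := \sum_(x in N) rG x.
have A_reps : A = (\sum_(x in coset_reps N K) rG x) *+ #|K|.
  rewrite /A (@sum_coset_reps _ [group of N] _ [group of K]) // => k g Kk Ng.
  by rewrite (@repr_mulg_ker _ _ _ [group of K]) // (fintype.subsetP sNG).
have cA : centgmx rG A.
  apply/centgmxP=> x Gx; rewrite mulmx_suml mulmx_sumr.
  have nNx : x^-1%g \in 'N(N)%g.
    by rewrite groupV (fintype.subsetP (normal_norm nNG)).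
  rewrite (reindex_inj (conjg_inj x^-1%g)) /=.
  apply: eq_big => [g | g]; rewrite memJ_norm // => /(fintype.subsetP sNG) Gg.
  by rewrite -!repr_mxM ?groupJ ?groupV // conjgE invgK -!mulgA mulVg mulg1.
(* If A is invertible, rG(x) A = A for x in N forces rG(x) = 1. If A = 0, the sum over N / K
   vanishes under sG as well, where it equals |N : K|, so p would divide this index. *)
have [A0 | nzA] := eqVneq A 0; last first.
  have uA := mx_Schur irrG cA nzA; apply/fintype.subsetP=> x Nx.
  have Gx := fintype.subsetP sNG x Nx; apply/rkerP; split=> //.
  apply: (can_inj (mulmxK uA)); rewrite mul1mx mulmx_sumr.
  rewrite [RHS](reindex_inj (mulgI x)) /=; apply: eq_big => g; first by rewrite groupMl.
  by move=> Ng; rewrite repr_mxM // (fintype.subsetP sNG).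
case/negP: index_rker_lies_over.
have sum0 : \sum_(x in coset_reps N K) rG x = (0%:~R)%:M.
  move/eqP: A0; rewrite A_reps -scaler_nat scalemx_eq0 pnatr_eq0.
  by rewrite (negPf (lt0n_neq0 (cardG_gt0 [group of K]))) raddf0 => /eqP.
have T_N x : x \in coset_reps N K -> x \in N by apply: coset_reps_sub.
have := lies_over_sum (fun x Tx => fintype.subsetP sNG x (T_N x Tx)) sum0.
rewrite (eq_bigr (fun=> 1%:M)) => [|x /T_N/rkerP[] //].
rewrite sumr_const raddf0 -scaler_nat scalemx1.
move=> /(@Fp_scalar_eq0 #|coset_reps N K|%:Z)[y] /(congr1 absz).
rewrite abszM !absz_nat (@card_coset_reps_sub [group of N] [group of K]) //.
by move->; apply: dvdn_mull.
Qed.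

End OnePrime.

(** Otherwise the lift of 1 acts as omega on rG, hence on sG, and as 0 on rG', hence on sG; the
    kernels agree because both equal that of sG. *)
Lemma lies_over_rsim n n' (rG : mx_representation rat G n)
    (rG' : mx_representation rat G n') P P' :
    mx_irreducible rG -> mx_irreducible rG' ->
    is_prime_ideal (repr_integers rG) P -> is_prime_ideal (repr_integers rG') P' ->
    lies_over rG P sG -> lies_over rG' P' sG ->
    ~~ (p %| repr_omega rG)%N -> ~~ (p %| repr_omega rG')%N ->
  mx_rsim rG rG'.
Proof.
move=> irrG irrG' primeP primeP' overP overP' p'o p'o'.
apply: contrapT => nsim.
have [z zE z0] := integer_lift irrG (repr_integers1 rG).
have zo : zop sG z = ((repr_omega rG)%:Z%:~R)%:M.
  apply: (lies_over_scalar primeP overP).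
  by rewrite zE -scaler_nat; apply: scalemx1.
have := overP' z; rewrite z0 //; last first.
  rewrite -(rker_lies_over irrG primeP overP p'o).
  by rewrite (rker_lies_over irrG' primeP' overP' p'o').
move=> /(_ (prime_ideal0 primeP')); rewrite zo => /Fp_scalar_eq0[y].
move/(congr1 absz); rewrite abszM !absz_nat => oE.
by case/negP: p'o; rewrite oE dvdn_mull.
Qed.

(* Value at x of the monic polynomial whose lower coefficients are listed in s. *)
Fixpoint monic_eval (T : pzRingType) (s : seq int) (x : T) : T :=
  if s is c :: s' then c%:~R + x * monic_eval s' x else 1.

Lemma monic_evalE (T : pzRingType) (q : {poly int}) (x : T) : q \is monic ->
  eval_intpoly q x = monic_eval (take (size q).-1 q) x.
Proof.
move=> /monicP lead_q; have q_gt0 : (0 < size q)%N.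
  by rewrite size_poly_gt0 -lead_coef_eq0 lead_q.
have evalE s : monic_eval s x = \sum_(k < size s) x ^+ k *~ s`_k + x ^+ size s.
  elim: s => [|c s IHs] /=; first by rewrite big_ord0 add0r.
  rewrite big_ord_recl expr0 -addrA; congr (_ + _).
  rewrite IHs mulrDr -exprS mulr_sumr; congr (_ + _).
  by apply: eq_bigr => k _; rewrite mulrzAr -exprS.
have ltq : ((size q).-1 < size q)%N by rewrite prednK.
rewrite evalE size_takel ?leq_pred // /eval_intpoly.
rewrite -(big_mkord xpredT (fun k => x ^+ k *~ q`_k)) -[in LHS](prednK q_gt0).
rewrite big_nat_recr //= -lead_coefE lead_q big_mkord; congr (_ + _).
by apply: eq_bigr => k _; rewrite nth_take.
Qed.

(** Induction on the coefficient list replaces the choice of a least degree: if A were not in P', no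
    monic integer polynomial could take a value in P' at A, whereas the integral equation of A gives
    the value 0. *)
Lemma lies_over_subset n (rG : mx_representation rat G n) P P' :
    mx_irreducible rG ->
    is_prime_ideal (repr_integers rG) P -> is_prime_ideal (repr_integers rG) P' ->
    P' p%:R -> lies_over rG P sG -> lies_over rG P' sG ->
    ~~ (p %| repr_omega rG)%N ->
  forall A, P A -> P' A.
Proof.
move=> irrG primeP primeP' P'p overP overP' p'o A PA; apply: contrapT => nP'A.
have OA := prime_ideal_sub primeP PA.
have O_eval s : repr_integers rG (monic_eval s A).
  elim: s => [|c s IHs] /=; first exact: repr_integers1.
  exact: (repr_integersD irrG (repr_integers_intr irrG c) (repr_integersM irrG OA IHs)).
have [_ nP'1 primeP'M] := primeP'.
have nP's s : ~ P' (monic_eval s A).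
  elim: s => [|c s IHs] //=; set B := monic_eval s A in IHs * => P'cAB.
  have PAB : P (A * B).
    have -> : A * B = B * A.
      by apply: (prime_ideal_sub primeP PA).1.2; case: (O_eval s) => -[].
    exact: (prime_idealMl primeP (O_eval s) PA).
  have [z zE _] := integer_lift irrG (prime_ideal_sub primeP PAB).
  have z0 : zop sG z = 0.
    apply: overP; rewrite zE pmulrn; exact: (prime_idealMz irrG primeP _ PAB).
  set o := repr_omega rG in zE p'o.
  (* This combination has image omega (c + A B) in P', so sG kills it. As sG also kills z, what
     remains is c omega = 0 in F_p. *)
  have := overP' (fun g => z g + if g == 1%g then c * o%:Z else 0).
  rewrite !zopD !zop_scalar z0 add0r zE => /(_ _)/Fp_scalar_eq0[].
    suff -> : A * B *+ o + ((c * o%:Z)%:~R)%:M = (c%:~R + A * B) *~ o%:Z.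
      exact: (prime_idealMz irrG primeP' _ P'cAB).
    rewrite -scalemx1 scaler_int mulrzDl addrC pmulrn; congr (_ + _).
    exact: mulrzA.
  move=> y co_eq; have [y' cE] : exists y', c = y' * p%:Z.
    have /dvdzP[y' cE] : (p %| c)%Z; last by exists y'.
      have : (p %| absz c * o)%N.
        by rewrite -[o]/(absz o%:Z) -abszM co_eq abszM dvdn_mull.
      by rewrite dvdzE Euclid_dvdM // (negPf p'o) orbF.
  have P'c : P' c%:~R.
    rewrite cE intrM; exact: (prime_idealMl primeP' (repr_integers_intr irrG y') P'p).
  have P'AB : P' (A * B).
    rewrite -[A * B](addKr c%:~R) addrC.
    exact: (prime_idealD primeP' P'cAB (prime_idealN irrG primeP' P'c)).
  by case: (primeP'M _ _ OA (O_eval s) P'AB).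
have [q monq q0] := OA.2; apply: (nP's (take (size q).-1 q)).
by rewrite -monic_evalE // [eval_intpoly _ _]q0; apply: prime_ideal0 primeP'.
Qed.

End LiesOver.

(** * Counting primes by modular representations *)

Lemma lies_over_mx_rsim (gT : finGroupType) (G : {group gT}) (F : fieldType) n
    (rG : mx_representation rat G n) P m m' (sG : mx_representation F G m)
    (sG' : mx_representation F G m') :
  mx_rsim sG sG' -> lies_over rG P sG -> lies_over rG P sG'.
Proof.
case/mx_rsim_sym/mx_rsim_def=> B [B' _ sG'E] overP z Pz.
transitivity (B *m zop sG z *m B'); last by rewrite overP // mulmx0 mul0mx.
rewrite /zop mulmx_sumr mulmx_suml; apply: eq_bigr => g Gg.
by rewrite sG'E // -!scaler_int -scalemxAr -scalemxAl.
Qed.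

Lemma primes_above_natr (gT : finGroupType) (G : {group gT}) n
    (rG : mx_representation rat G n) p P : primes_above rG p P -> P p%:R.
Proof.
case=> primeP [K [sKO _ _ _]] eqPK.
have [s PKs ->] : ideal_mul P K p%:R.
  by rewrite -eqPK; exists 1 => //; apply: repr_integers1.
rewrite big_seq; apply: (big_ind P) => [||ab /PKs[Pa Kb]].
- exact: prime_ideal0 primeP.
- exact: prime_idealD primeP.
have [_ cb] := (sKO _ Kb).1; have [ea _] := (prime_ideal_sub primeP Pa).1.
by rewrite -cb //; apply: (prime_idealMl primeP (sKO _ Kb) Pa).
Qed.

(** For an infinite A the finite set [fset_set A] is empty and the claim is vacuous. *)
Lemma mem_fset_set (T : choiceType) (A : set T) x : x \in fset_set A -> A x.
Proof.
have [finA | nfinA] := pselect (finite_set A).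
  by rewrite in_fset_set // inE.
by rewrite /fset_set; case: pselect.
Qed.

Lemma num_primes_above_le (gT : finGroupType) (G : {group gT}) n
    (rG : mx_representation rat G n) p (J : finType) (R : set 'M[rat]_n -> J -> Prop) :
    (forall P, primes_above rG p P -> exists j, R P j) ->
    (forall P P' j, primes_above rG p P -> primes_above rG p P' ->
       R P j -> R P' j -> P = P') ->
  (num_primes_above rG p
     <= #|[set j | `[< exists2 P, primes_above rG p P & R P j >]]|)%N.
Proof.
move=> exR injR; set S := [set j | _].
(* J may be empty, so the choice function takes values in [option J], with [None] outside the primes
   above p. *)
have /choice[f fP] P : exists o, primes_above rG p P ->
    exists2 j, o = Some j & R P j.
  have [/exR[j Rj] | nP] := pselect (primes_above rG p P); last by exists None.
  by exists (Some j) => _; exists j.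
have sub : {subset [seq f P | P <- fset_set (primes_above rG p)]
             <= [seq Some j | j <- enum S]}.
  move=> o /mapP[P /mem_fset_set aP ->]; have [j -> Rj] := fP P aP.
  by rewrite map_f // mem_enum inE; apply/asboolP; exists P.
have uniq_f : uniq [seq f P | P <- fset_set (primes_above rG p)].
  rewrite map_inj_in_uniq ?fset_uniq // => P P' /mem_fset_set aP /mem_fset_set aP'.
  have [j -> Rj] := fP P aP; have [j' -> Rj'] := fP P' aP'.
  by case=> eqj; apply: (injR _ _ j); rewrite // eqj.
have := uniq_leq_size uniq_f sub; rewrite !size_map -cardE.
by rewrite /num_primes_above cardfE.
Qed.

Theorem theoremB (gT : finGroupType) (G : {group gT}) (p : nat)
    (p_prime : prime p) (p_dvd : (p %| #|G|)%N)
    (I : finType) (rho : I -> representation rat G) (rho_irr : irr_system rho)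
    (J : finType) (sigma : J -> representation 'F_p G)
    (sigma_irr : irr_system sigma) :
  (#|J| >= \sum_(i : I | ~~ (p %| repr_omega (rho i))) num_primes_above (rho i) p)%N.
Proof.
have [irr_rho inj_rho _] := rho_irr; have [irr_sigma _ all_sigma] := sigma_irr.
pose R i (P : set 'M[rat]_(rdegree (rho i))) j := lies_over (rho i) P (sigma j).
pose S i := [set j | `[< exists2 P, primes_above (rho i) p P & R i P j >]].
have le_num i : ~~ (p %| repr_omega (rho i))%N ->
    (num_primes_above (rho i) p <= #|S i|)%N.
  move=> p'o; apply: num_primes_above_le => [P aP | P P' j aP aP' RP RP'].
    have [m [sG [irrS overP]]] :=
      exists_lies_over (irr_rho i) aP.1 p_prime (primes_above_natr aP).
    have [j sG_j] := all_sigma _ _ irrS.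
    by exists j; apply: lies_over_mx_rsim overP.
  have [P'p Pp] := (primes_above_natr aP', primes_above_natr aP).
  apply/predeqP=> A; split.
    exact: (lies_over_subset p_prime (irr_sigma j) (irr_rho i) aP.1 aP'.1).
  exact: (lies_over_subset p_prime (irr_sigma j) (irr_rho i) aP'.1 aP.1).
apply: leq_trans (leq_sum _ le_num) _.
(* Double counting: after exchanging the sums, each j contributes at most 1 because it lies in [S i]
   for at most one admissible i. *)
under eq_bigr do rewrite -sum1_card big_mkcond.
rewrite exchange_big /= -sum1_card; apply: leq_sum => j _.
rewrite -big_mkcondr sum1_card; apply/card_le1_eqP => i i'.
have inS k : (~~ (p %| repr_omega (rho k))%N) && (j \in S k) ->
    ~~ (p %| repr_omega (rho k))%N
      /\ exists2 P, primes_above (rho k) p P & R k P j.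
  by case/andP=> p'o; rewrite inE => /asboolP.
move=> /inS[p'o [P [primeP _] overP]] /inS[p'o' [P' [primeP' _] overP']].
apply: inj_rho.
exact: (lies_over_rsim p_prime (irr_sigma j) _ _ primeP' primeP overP' overP p'o' p'o).
Qed.
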